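(* Let $G$ be a connected graph with $n$ vertices, and let $\Delta$ and $\delta$ denote its maximum and minimum degree. Then $$BSO(G)\leq \sqrt{2M_2^{*}(G)\,SDD(G)},$$ with equality if and only if $G$ is a regular graph (when $G$ is non-bipartite) or $G$ is a $(\Delta,\delta)$-semiregular bipartite graph (when $G$ is bipartite).
   Context: Graphs are finite, simple and undirected. For a connected graph $G$ with edge set $E(G)$, $d_v$ denotes the degree of the vertex $v$ in $G$. The first Banhatti-Sombor index is $BSO(G)=\sum_{uv\in E(G)}\sqrt{\frac{1}{d_u^2}+\frac{1}{d_v^2}}$, the modified second Zagreb index is $M_2^{*}(G)=\sum_{uv\in E(G)}\frac{1}{d_ud_v}$, and the symmetric division deg index is $SDD(G)=\sum_{uv\in E(G)}\frac{d_u^2+d_v^2}{2d_ud_v}$. A graph $G$ is called $(\Delta,\delta)$-semiregular if $\{d_u,d_v\}=\{\Delta,\delta\}$ holds for all edges $uv\in E(G)$ (the case $\Delta=\delta$ is allowed). *)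

(* Defs.v *)
From mathcomp Require Import all_boot all_order all_algebra.

Set Implicit Arguments.
Unset Strict Implicit.
Unset Printing Implicit Defensive.

Import Order.TTheory GRing.Theory Num.Theory.
Local Open Scope ring_scope.

Section Graph.

(* A simple graph on the vertex set [T] is given by its adjacency relation [e];
   symmetry and irreflexivity are hypotheses of the theorem. *)
Variables (T : finType) (e : rel T).

Definition connected_graph : Prop :=
  (0 < #|T|)%N /\ forall u v : T, connect e u v.

Definition deg (v : T) : nat := #|[set w | e v w]|.

Definition max_deg : nat := (\max_(v : T) deg v)%N.

(* The default value #|T| strictly exceeds every degree of a simple graph, so
   it plays no role as soon as there is a vertex. *)
Definition min_deg : nat := \big[minn/#|T|]_(v : T) deg v.

Definition bipartite : bool :=
  [exists A : {set T}, [forall u, forall v,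
     e u v ==> ((u \in A) != (v \in A))]].

Definition regular : Prop := exists k : nat, forall v : T, deg v = k.

(* [=i] on two-element sequences is equality of the sets {d_u, d_v} and
   {D, d}. *)
Definition semiregular (D d : nat) : Prop :=
  forall u v : T, e u v -> [:: deg u; deg v] =i [:: D; d].

Variable R : rcfType.

(* Each edge uv contributes once: among its two orientations we keep the one
   that is increasing for the enumeration of [T]. This choice is immaterial
   when [f] is symmetric, as in all the uses below. *)
Definition edge_sum (f : T -> T -> R) : R :=
  \sum_(p : T * T | e p.1 p.2 && (enum_rank p.1 < enum_rank p.2)%N) f p.1 p.2.

Definition BSO : R :=
  edge_sum (fun u v => Num.sqrt (1 / (deg u)%:R ^+ 2 + 1 / (deg v)%:R ^+ 2)).

Definition M2star : R :=
  edge_sum (fun u v => 1 / ((deg u)%:R * (deg v)%:R)).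

Definition SDD : R :=
  edge_sum (fun u v => ((deg u)%:R ^+ 2 + (deg v)%:R ^+ 2)
                       / (2 * (deg u)%:R * (deg v)%:R)).

End Graph.

(* Main.v *)
Require Import Defs.
From mathcomp Require Import all_boot all_order all_algebra.
From mathcomp Require Import ring.

(** For an edge [uv] put [w = 1 / (d_u d_v)] and [t = sqrt (d_u^2 + d_v^2)].
    Then [BSO], [M2star] and [2 SDD] are the sums over the edges of [w t], [w]
    and [w t^2], so the inequality is the Cauchy-Schwarz inequality
    [(sum w t)^2 <= (sum w) (sum w t^2)].  Lagrange's identity
    ([weighted_lagrange]) writes the defect as half of the double sum of
    [w_i w_j (t_i - t_j)^2]; as the weights are positive, equality holds iff
    [t], that is [d_u^2 + d_v^2], is the same for all edges
    ([BSO_eq_iff_balanced]).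

    It remains to recognise these graphs.  If [d_u^2 + d_v^2] is constant, the
    degree of one end of an edge determines that of the other end, so the two
    degrees [a] and [b] found on one edge propagate by connectedness to the
    whole graph ([balanced_semiregular]).  If [a] and [b] differ, the vertices
    of degree [a] are one side of a bipartition; hence a non-bipartite such
    graph is regular. *)

Set Implicit Arguments.
Unset Strict Implicit.
Unset Printing Implicit Defensive.

Import Order.TTheory GRing.Theory Num.Theory.
Local Open Scope ring_scope.

(** * Weighted Cauchy-Schwarz inequality and its equality case *)

Section WeightedCauchySchwarz.

Variables (I : finType) (P : pred I).

Lemma weighted_lagrange (R : comPzRingType) (w t : I -> R) :
  \sum_(i | P i) \sum_(j | P j) w i * w j * (t i - t j) ^+ 2 =
  2 * ((\sum_(i | P i) w i) * (\sum_(i | P i) w i * t i ^+ 2)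
       - (\sum_(i | P i) w i * t i) ^+ 2).
Proof.
have split_square i j : w i * w j * (t i - t j) ^+ 2 =
    w i * t i ^+ 2 * w j + w i * (w j * t j ^+ 2)
    - 2 * (w i * t i) * (w j * t j) by ring.
under eq_bigr => i _ do
  rewrite (eq_bigr _ (fun j _ => split_square i j)) sumrB big_split /=
          -!mulr_sumr.
rewrite sumrB big_split /= -!mulr_suml -mulr_sumr.
by ring.
Qed.

Variables (R : realFieldType) (w t : I -> R).
Hypothesis w_gt0 : forall i, P i -> 0 < w i.

Let term_ge0 i j : P i -> P j -> 0 <= w i * w j * (t i - t j) ^+ 2.
Proof. by move=> /w_gt0 wi /w_gt0 wj; rewrite mulr_ge0 ?sqr_ge0 // ltW ?mulr_gt0. Qed.

Lemma weighted_cauchy_schwarz :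
  (\sum_(i | P i) w i * t i) ^+ 2 <=
  (\sum_(i | P i) w i) * (\sum_(i | P i) w i * t i ^+ 2).
Proof.
rewrite -subr_ge0 -(@pmulr_rge0 _ 2) // -weighted_lagrange.
by apply: sumr_ge0 => i Pi; apply: sumr_ge0 => j; apply: term_ge0.
Qed.

Lemma weighted_cauchy_schwarz_eq :
  (\sum_(i | P i) w i * t i) ^+ 2 =
    (\sum_(i | P i) w i) * (\sum_(i | P i) w i * t i ^+ 2)
  <-> (forall i j, P i -> P j -> t i = t j).
Proof.
have -> : (\sum_(i | P i) w i * t i) ^+ 2 =
    (\sum_(i | P i) w i) * (\sum_(i | P i) w i * t i ^+ 2)
  <-> \sum_(i | P i) \sum_(j | P j) w i * w j * (t i - t j) ^+ 2 = 0.
  rewrite weighted_lagrange; split=> [->|/eqP]; first by rewrite subrr mulr0.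
  by rewrite mulf_eq0 pnatr_eq0 /= subr_eq0 => /eqP ->.
split=> [sum0 i j Pi Pj | t_const].
  have inner0 : \sum_(j | P j) w i * w j * (t i - t j) ^+ 2 = 0.
    by apply: (psumr_eq0P _ sum0) => // k Pk; apply: sumr_ge0 => l; apply: term_ge0.
  have /eqP := psumr_eq0P (fun l Pl => term_ge0 Pi Pl) inner0 Pj.
  by rewrite !mulf_eq0 !(gt_eqF (w_gt0 _)) //= orbb subr_eq0 => /eqP.
rewrite big1 // => i Pi; rewrite big1 // => j Pj.
by rewrite (t_const i j) // subrr expr0n mulr0.
Qed.

End WeightedCauchySchwarz.

(** * Graphs in which [d_u^2 + d_v^2] is constant on edges *)

Section DegreeStructure.

Variables (T : finType) (e : rel T).
Hypothesis e_sym : symmetric e.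

(** The equality case of Cauchy-Schwarz for the three indices. *)
Definition balanced : Prop := forall u v u' v', e u v -> e u' v' ->
  (deg e u ^ 2 + deg e v ^ 2 = deg e u' ^ 2 + deg e v' ^ 2)%N.

Lemma deg_gt0 u v : e u v -> (0 < deg e u)%N.
Proof. by move=> euv; apply/card_gt0P; exists v; rewrite inE. Qed.

Lemma deg_le_max v : (deg e v <= max_deg e)%N.
Proof. exact: leq_bigmax. Qed.

Lemma min_le_deg v : (min_deg e <= deg e v)%N.
Proof.
rewrite /min_deg; have: v \in index_enum T by rewrite mem_index_enum.
elim: (index_enum T) => // x s IHs; rewrite inE big_cons geq_min.
by case/predU1P=> [->|/IHs ->]; rewrite ?leqnn ?orbT.
Qed.

Lemma max_deg_two_values u v :
  (forall x, deg e x \in [:: deg e u; deg e v]) ->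
  max_deg e = maxn (deg e u) (deg e v).
Proof.
move=> two; apply/eqP; rewrite eqn_leq geq_max !deg_le_max !andbT.
apply/bigmax_leqP => x _; have := two x; rewrite !inE.
by case/orP=> /eqP ->; rewrite ?leq_maxl ?leq_maxr.
Qed.

Lemma min_deg_two_values u v :
  (forall x, deg e x \in [:: deg e u; deg e v]) ->
  min_deg e = minn (deg e u) (deg e v).
Proof.
move=> two; apply/eqP; rewrite eqn_leq leq_min !min_le_deg /=.
apply: (big_ind (fun m => minn (deg e u) (deg e v) <= m)%N).
(* The minimum starts from [#|T|], which bounds every degree. *)
- by rewrite geq_min max_card.
- by move=> x y; rewrite [(_ <= minn x y)%N]leq_min => -> ->.
move=> x _; have := two x; rewrite !inE.
by case/orP=> /eqP ->; rewrite ?geq_minl ?geq_minr.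
Qed.

Lemma semiregular_edge D d u v : semiregular e D d -> e u v ->
  (deg e u = D /\ deg e v = d) \/ (deg e u = d /\ deg e v = D).
Proof.
move=> sr euv; have := sr u v euv; set x := deg e u; set y := deg e v => Exy.
have := Exy x; have := Exy y; have := Exy D; have := Exy d.
rewrite !inE !eqxx ?orbT /= => hd hD /esym hy /esym hx.
by case/orP: hx hy hd hD => /eqP-> /orP[]/eqP-> /orP[]/eqP e1 /orP[]/eqP e2;
   subst; auto.
Qed.

Lemma semiregular_balanced D d : semiregular e D d -> balanced.
Proof.
move=> sr u v u' v' /(semiregular_edge sr) h /(semiregular_edge sr) h'.
by case: h h' => [][-> ->] [][-> ->] //; rewrite addnC.
Qed.

Lemma regular_balanced : regular e -> balanced.
Proof. by case=> k deg_k u v u' v'; rewrite !deg_k. Qed.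

Lemma semiregular_bipartite D d :
  semiregular e D d -> D != d -> bipartite e.
Proof.
move=> sr neqDd; apply/existsP; exists [set x | deg e x == D].
apply/forallP => u; apply/forallP => v; apply/implyP.
move=> /(semiregular_edge sr); rewrite !inE eq_sym.
by case=> [][-> ->]; rewrite eqxx [d == D]eq_sym (negPf neqDd).
Qed.

(** The set of vertices whose degree is one of the two degrees on a given edge
    is closed under adjacency, hence is everything. *)
Lemma balanced_semiregular : (forall u v, connect e u v) -> balanced ->
  semiregular e (max_deg e) (min_deg e).
Proof.
move=> conn bal u v euv.
have two x : deg e x \in [:: deg e u; deg e v].
  pose A := [pred y | deg e y \in [:: deg e u; deg e v]].
  have closedA : closed e A.
    apply: intro_closed; first exact: sym_connect_sym.
    move=> y z eyz; rewrite !inE => yA; have := bal _ _ _ _ eyz euv.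
    by case/orP: yA => /eqP ->; [|rewrite [RHS]addnC];
      move/addnI/eqP; rewrite eqn_exp2r // => ->; rewrite ?orbT.
  by have := closed_connect closedA (conn u x); rewrite !inE eqxx => <-.
rewrite (max_deg_two_values two) (min_deg_two_values two) => k.
by rewrite !inE; case: leqP => // _; rewrite orbC.
Qed.

Lemma eq_max_min_regular : max_deg e = min_deg e -> regular e.
Proof.
move=> eqMm; exists (max_deg e) => x; apply/eqP.
by rewrite eqn_leq deg_le_max eqMm min_le_deg.
Qed.

Lemma balanced_iff : (forall u v, connect e u v) ->
  balanced <-> (~~ bipartite e /\ regular e) \/
               (bipartite e /\ semiregular e (max_deg e) (min_deg e)).
Proof.
move=> conn; split=> [bal|[[_]|[_]]]; last first.
- exact: semiregular_balanced.
- exact: regular_balanced.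
have sr := balanced_semiregular conn bal.
have [bip|nbip] := boolP (bipartite e); [by right | left; split=> //].
apply: eq_max_min_regular; apply/eqP; apply: contraNT nbip.
exact: semiregular_bipartite sr.
Qed.

End DegreeStructure.

(** * The three indices as weighted sums *)

Section Indices.

Variables (R : rcfType) (T : finType) (e : rel T).
Hypotheses (e_sym : symmetric e) (e_irr : irreflexive e).

Let E : pred (T * T) :=
  [pred p | e p.1 p.2 && (enum_rank p.1 < enum_rank p.2)%N].
Let w (p : T * T) : R := 1 / ((deg e p.1)%:R * (deg e p.2)%:R).
Let t (p : T * T) : R :=
  Num.sqrt ((deg e p.1)%:R ^+ 2 + (deg e p.2)%:R ^+ 2).

Let degs_gt0 p : E p -> 0 < (deg e p.1)%:R :> R /\ 0 < (deg e p.2)%:R :> R.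
Proof.
by case/andP=> ep _; rewrite !ltr0n (deg_gt0 ep) (@deg_gt0 _ _ _ p.1) // e_sym.
Qed.

Let w_gt0 p : E p -> 0 < w p.
Proof. by move=> /degs_gt0[a b]; rewrite divr_gt0 ?mulr_gt0. Qed.

Let t_sqr p : t p ^+ 2 = (deg e p.1)%:R ^+ 2 + (deg e p.2)%:R ^+ 2.
Proof. by rewrite sqr_sqrtr // addr_ge0 ?sqr_ge0. Qed.

Lemma BSO_weighted : BSO e R = \sum_(p | E p) w p * t p.
Proof.
apply: eq_bigr => p /[dup] /w_gt0 wp /degs_gt0[a b].
rewrite -{1}[w p]ger0_norm ?ltW // -sqrtr_sqr -sqrtrM ?sqr_ge0 //.
congr Num.sqrt; rewrite /w; field.
by rewrite !gt_eqF.
Qed.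

Lemma SDD_weighted : 2 * SDD e R = \sum_(p | E p) w p * t p ^+ 2.
Proof.
rewrite mulr_sumr; apply: eq_bigr => p /degs_gt0[a b].
by rewrite t_sqr /w; field; rewrite !gt_eqF.
Qed.

Lemma BSO_sqr_le : BSO e R ^+ 2 <= 2 * M2star e R * SDD e R.
Proof.
rewrite mulrAC mulrC SDD_weighted BSO_weighted.
exact: weighted_cauchy_schwarz.
Qed.

Lemma BSO_ge0 : 0 <= BSO e R.
Proof. by apply: sumr_ge0 => p _; apply: sqrtr_ge0. Qed.

Lemma BSO_le : BSO e R <= Num.sqrt (2 * M2star e R * SDD e R).
Proof. by rewrite -[leLHS]ger0_norm ?BSO_ge0 // -sqrtr_sqr ler_wsqrtr ?BSO_sqr_le. Qed.

(** The index sums see one orientation of each edge; as [d_u^2 + d_v^2] is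
    symmetric, constancy on these orientations is constancy on all edges. *)
Lemma balancedP : (forall p q, E p -> E q -> t p = t q) <-> balanced e.
Proof.
have t_natE p : t p = Num.sqrt (deg e p.1 ^ 2 + deg e p.2 ^ 2)%:R.
  by rewrite /t natrD !natrX.
split=> [t_const | bal p q /andP[ep _] /andP[eq _]]; last first.
  by rewrite !t_natE (bal _ _ _ _ ep eq).
have orient u v : e u v -> exists2 p, E p &
    (deg e u ^ 2 + deg e v ^ 2 = deg e p.1 ^ 2 + deg e p.2 ^ 2)%N.
  move=> euv; case: (ltngtP (enum_rank u) (enum_rank v)) => [lt|lt|eqr].
  - by exists (u, v) => //; rewrite /E inE /= euv.
  - by exists (v, u); [rewrite /E inE /= e_sym euv | rewrite addnC].
  - by move: euv; rewrite (enum_rank_inj (val_inj eqr)) e_irr.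
move=> u v u' v' /orient[p Ep ->] /orient[q Eq ->].
have /eqP := t_const p q Ep Eq.
by rewrite !t_natE eqr_sqrt ?ler0n // eqr_nat => /eqP.
Qed.

Lemma BSO_eq_iff_balanced :
  BSO e R = Num.sqrt (2 * M2star e R * SDD e R) <-> balanced e.
Proof.
have BSO_sqr_eq : BSO e R = Num.sqrt (2 * M2star e R * SDD e R) <->
    BSO e R ^+ 2 = M2star e R * (2 * SDD e R).
  have -> : M2star e R * (2 * SDD e R) = 2 * M2star e R * SDD e R by ring.
  split=> [->|<-]; last by rewrite sqrtr_sqr ger0_norm ?BSO_ge0.
  by rewrite sqr_sqrtr // (le_trans (sqr_ge0 _) BSO_sqr_le).
rewrite BSO_sqr_eq SDD_weighted BSO_weighted -balancedP.
exact: weighted_cauchy_schwarz_eq.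
Qed.

End Indices.

Theorem theorem3p12 (R : rcfType) (T : finType) (e : rel T)
  (e_sym : symmetric e) (e_irr : irreflexive e) (e_conn : connected_graph e) :
  BSO e R <= Num.sqrt (2 * M2star e R * SDD e R) /\
  (BSO e R = Num.sqrt (2 * M2star e R * SDD e R) <->
     (~~ bipartite e /\ regular e) \/
     (bipartite e /\ semiregular e (max_deg e) (min_deg e))).
Proof.
split; first exact: BSO_le.
by rewrite BSO_eq_iff_balanced // balanced_iff //; case: e_conn.
Qed.
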